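(* Let $X$ be a real Banach space. If $X$ has Property $(II)$, then $X$ has the Ball Generated Property (BGP). If $X$ has the BGP, then $X$ is nicely smooth.
   Context: All Banach spaces are real. $X$ has Property $(II)$ if every closed bounded convex set in $X$ is an intersection of sets each of which is the closed convex hull of a finite union of closed balls. $X$ has the BGP if every closed bounded convex set in $X$ is ball-generated, i.e., an intersection of sets each of which is a finite union of closed balls. A set $A\subseteq B(X^* )$ (closed unit ball of $X^*$) is a norming set for $X$ if $\|x\|=\sup\{x^*(x):x^*\in A\}$ for all $x\in X$. A closed subspace $F\subseteq X^*$ is a norming subspace if its closed unit ball $B(F)$ is a norming set for $X$. $X$ is nicely smooth if $X^*$ contains no proper norming (closed) subspace. *)

(* Defs.v *)
From HB Require Import structures.
From mathcomp Require Import all_boot all_order all_algebra.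
From mathcomp Require Import all_classical all_reals all_analysis.

Set Implicit Arguments.
Unset Strict Implicit.
Unset Printing Implicit Defensive.

Import Order.TTheory GRing.Theory Num.Theory.
Import numFieldNormedType.Exports.

Local Open Scope classical_set_scope.
Local Open Scope ring_scope.

Section Dual.
Variables (R : realType) (X : normedModType R).

Definition continuous_linear : {pred (X -> R^o)} :=
  fun f => `[< linear f /\ continuous f >].

(* The topological dual X^* of X, normed below by the operator norm. *)
Record dual : Type :=
  Dual { dual_fun :> X -> R^o ; _ : dual_fun \in continuous_linear }.

HB.instance Definition _ := [isSub for dual_fun].
HB.instance Definition _ := [Choice of dual by <:].

Lemma continuous_linear_submod_closed : submod_closed continuous_linear.
Proof.
split.
  by apply/asboolP; split; [move=> a x y /=; rewrite scaler0 addr0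
                           |move=> x; exact: cvg_cst].
move=> a f g /asboolP[lf cf] /asboolP[lg cg]; apply/asboolP; split.
  move=> b x y.
  have E z : (a *: f + g) z = a *: f z + g z by [].
  by rewrite !E lf lg !scalerDr !scalerA (mulrC a) addrACA.
move=> x; apply: (@continuousD _ _ _ (a *: f) g x) (cg x).
exact: (@continuousZl_tmp _ _ _ f a x (cf x)).
Qed.

HB.instance Definition _ := GRing.isSubmodClosed.Build R (X -> R^o)
  continuous_linear continuous_linear_submod_closed.
HB.instance Definition _ := [SubChoice_isSubLmodule of dual by <:].

Definition dual_norm (f : dual) : R :=
  sup [set `|f x| | x in [set x | `|x| <= 1]].

Lemma dualD (f g : dual) x : (f + g) x = f x + g x. Proof. by []. Qed.

Lemma dualZ (a : R) (f : dual) x : (a *: f) x = a *: f x. Proof. by []. Qed.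

Lemma dual_linear (f : dual) : linear f.
Proof. by case: f => f /= /asboolP[]. Qed.

Lemma dual_continuous (f : dual) : continuous f.
Proof. by case: f => f /= /asboolP[]. Qed.

Lemma dual_has_sup (f : dual) :
  has_sup [set `|f x| | x in [set x | `|x| <= 1]].
Proof.
split; first by exists `|f 0|, 0 => //=; rewrite normr0.
pose g : {linear X -> R^o} :=
  HB.pack (dual_fun f) (GRing.isLinear.Build _ _ _ _ _ (dual_linear f)).
have /linear_bounded_continuous/linear_boundedP/pinfty_ex_gt0[M M0 gM] :
  continuous g by exact: dual_continuous.
exists M => _ [x /= x1 <-]; apply: (le_trans (gM x)).
by rewrite -[leRHS]mulr1 ler_wpM2l// ltW.
Qed.

Lemma dual_norm_ub (f : dual) x : `|x| <= 1 -> `|f x| <= dual_norm f.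
Proof.
by move=> x1; apply: ub_le_sup; [case: (dual_has_sup f)|exists x].
Qed.

Lemma dual_norm_le (f : dual) (M : R) :
  (forall x, `|x| <= 1 -> `|f x| <= M) -> dual_norm f <= M.
Proof.
move=> fM; apply: ge_sup; first by case: (dual_has_sup f).
by move=> _ [x /= x1 <-]; exact: fM.
Qed.

Let dual_normD (f g : dual) : dual_norm (f + g) <= dual_norm f + dual_norm g.
Proof.
apply: dual_norm_le => x x1; rewrite dualD (le_trans (ler_normD _ _))//.
by rewrite lerD// dual_norm_ub.
Qed.

Let dual_normZ (a : R) (f : dual) : dual_norm (a *: f) = `|a| * dual_norm f.
Proof.
have H (b : R) (h : dual) : dual_norm (b *: h) <= `|b| * dual_norm h.
  by apply: dual_norm_le => x x1; rewrite dualZ normrZ ler_wpM2l// dual_norm_ub.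
apply/eqP; rewrite eq_le H /=.
have [->|a0] := eqVneq a 0.
  rewrite normr0 mul0r (le_trans (normr_ge0 ((0 *: f : dual) 0)))//.
  by rewrite dual_norm_ub// normr0.
rewrite -ler_pdivlMl ?normr_gt0// -normfV.
by rewrite -[X in dual_norm X <= _](scalerK a0) H.
Qed.

Let dual_norm0_eq0 (f : dual) : dual_norm f = 0 -> f = 0.
Proof.
move=> f0; apply: val_inj; apply/funext => x /=.
have f00 : f 0 = 0.
  by have := dual_linear f (-1) 0 0; rewrite scaler0 addr0 scaleN1r addNr.
have [->//|x0] := eqVneq x 0.
have : `|f (`|x|^-1 *: x + 0)| <= 0.
  by rewrite -f0 dual_norm_ub// addr0 normrZ normfV normr_id mulVf// normr_eq0.
rewrite (dual_linear f) f00 addr0 normrZ normfV normr_id pmulr_rle0.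
  by rewrite normr_le0 => /eqP.
by rewrite invr_gt0 normr_gt0.
Qed.

HB.instance Definition _ :=
  Lmodule_isNormed.Build R dual dual_normD dual_normZ dual_norm0_eq0.

End Dual.

Section BallProperties.
Variables (R : realType) (X : normedModType R).

Definition intersection_of (C : set (set X)) (A : set X) : Prop :=
  exists2 G : set (set X), G `<=` C & A = \bigcap_(U in G) U.

(* The radius is positive: the library's closed_ball x r is the closure of the
   open ball, hence empty for r <= 0. *)
Definition closed_balls : set (set X) :=
  [set B | exists x r, 0 < r /\ B = closed_ball x r].

Definition finite_ball_unions : set (set X) :=
  [set U | exists2 F : set (set X),
     finite_set F /\ F `<=` closed_balls & U = \bigcup_(B in F) B].

Definition closed_convex_hull (A : set X) : set X :=
  smallest (fun C : set X => closed C /\ convex_set C) A.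

Definition property_II : Prop :=
  forall A : set X, closed A -> bounded_set A -> convex_set A ->
    intersection_of [set closed_convex_hull U | U in finite_ball_unions] A.

Definition BGP : Prop :=
  forall A : set X, closed A -> bounded_set A -> convex_set A ->
    intersection_of finite_ball_unions A.

End BallProperties.

Section NicelySmooth.
Variables (R : realType) (X : normedModType R).

Definition dual_unit_ball : set (dual X) := [set f | `|f| <= 1].

Definition norming_set (A : set (dual X)) : Prop :=
  A `<=` dual_unit_ball /\
  forall x : X, `|x|%:E = ereal_sup [set (f x)%:E | f in A].

Definition closed_subspace (F : set (dual X)) : Prop :=
  closed F /\ submod_closed (mem F).

Definition norming_subspace (F : set (dual X)) : Prop :=
  closed_subspace F /\ norming_set (F `&` dual_unit_ball).

Definition nicely_smooth : Prop :=
  ~ exists2 F : set (dual X), norming_subspace F & F `<` [set: dual X].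

End NicelySmooth.

(* Main.v *)
Require Import Defs.
From mathcomp Require Import all_boot all_order all_algebra.
From mathcomp Require Import all_classical all_reals all_analysis.
From mathcomp Require Import ring lra.

(** Both implications rest on replacing a covering by a finite one.

    Property (II) implies the BGP because a convex hull of finitely many balls is
    nearly a finite union of balls. The balls [B(z, r)] are points [(z, r)] of
    [X * R], and the convex hull of the balls [B(z_i, r_i)] is the union of the
    balls [B(z, r)] with [(z, r)] in the convex hull [K] of the points
    [(z_i, r_i)]. This [K] is compact. A point [x] at positive distance from the
    hull has at least that distance from all these balls, so replacing [K] by a
    fine enough finite net, and enlarging the balls slightly, gives finitely many
    closed balls that cover the hull and miss [x]
    ([hull_finite_ball_union_sep]).

    The BGP implies nice smoothness because a finite covering by balls missing 0
    becomes a finite set of functionals. Let [F] be a norming closed subspace of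
    the dual, [f] a functional and [c > 0]. The slice [|x| <= 1, c <= f x] is
    covered by finitely many balls missing 0, and each lies in a half-space
    [0 < g_i] with [g_i] in [F]. So the slice misses the common kernel of the
    [g_i], that is, [f] has norm at most [c] there. By a finite-codimensional
    Hahn-Banach argument ([dominated_modulo_span]) some combination of the [g_i]
    is within [c] of [f]. As [c] is arbitrary and [F] is closed, [f] lies in
    [F]. *)

Set Implicit Arguments.
Unset Strict Implicit.
Unset Printing Implicit Defensive.

Import Order.TTheory GRing.Theory Num.Theory.
Import numFieldNormedType.Exports.

Local Open Scope classical_set_scope.
Local Open Scope ring_scope.

(** * Intersections, convexity and closed balls *)

(** This turns both ball properties into separation properties: each point
    outside a closed bounded convex set must be excluded by a single member
    of the class that contains the whole set. *)
Lemma intersection_ofP (R : realType) (X : normedModType R)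
    (C : set (set X)) (A : set X) :
  intersection_of C A <->
  forall x, ~ A x -> exists2 V, C V & A `<=` V /\ ~ V x.
Proof.
split=> [[G GC ->] x|sep].
  move=> /existsNP[V /not_implyP[GV Vx]]; exists V; first exact: GC.
  by split=> // y; exact.
exists [set V | C V /\ A `<=` V]; first by move=> V [].
rewrite eqEsubset; split=> [y Ay V [_]|x Ax]; first exact.
by apply: contrapT => /sep[V CV [AV]]; apply; exact: Ax.
Qed.

Lemma convexP (R : realType) (V : lmodType R) (A : set V) :
  convex_set A <-> forall x y a, A x -> A y -> 0 <= a -> a <= 1 ->
    A (a *: x + (1 - a) *: y).
Proof.
split=> [cA x y a Ax Ay a0 a1|cA x y l /set_mem Ax /set_mem Ay].
  have a01 : Itv.spec (Itv.num_sem (R := R)) (Itv.Real `[0%Z, 1%Z]) a.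
    by rewrite /= /Itv.num_sem/= realE a0 in_itv /= a0 a1.
  by have /set_mem := cA x y (Itv.mk a01) (mem_set Ax) (mem_set Ay).
by apply/mem_set; exact: cA.
Qed.

Lemma closed_ballP (R : realType) (V : normedModType R) (z : V) r y : 0 < r ->
  closed_ball z r y <-> `|z - y| <= r.
Proof. by move=> r0; rewrite closed_ballE. Qed.

Lemma closureP (R : realType) (V : normedModType R) (A : set V) x :
  closure A x <-> forall e, 0 < e -> exists2 y, A y & `|x - y| < e.
Proof.
split=> [cA e e0|H B /nbhs_ballP[e /= e0 eB]].
  by have [y [Ay]] := cA _ (nbhsx_ballx x e e0); rewrite -ball_normE; exists y.
have [y Ay xy] := H e e0; exists y; split=> //; apply: eB.
by rewrite -ball_normE.
Qed.

Lemma closed_dist_gt0 (R : realType) (V : normedModType R) (A : set V) x :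
  closed A -> ~ A x -> exists2 d, 0 < d & forall y, A y -> d <= `|x - y|.
Proof.
move=> cA Ax; have : ~ closure A x by rewrite -(closure_id A).1.
move=> /closureP/existsNP[d /not_implyP[d0 H]]; exists d => // y Ay.
by rewrite leNgt; apply/negP => xy; apply: H; exists y.
Qed.

Lemma closure_convex (R : realType) (V : normedModType R) (A : set V) :
  convex_set A -> convex_set (closure A).
Proof.
move=> /convexP cA; apply/convexP => x y a /closureP cx /closureP cy a0 a1.
apply/closureP => e e0; have [x' Ax' xx'] := cx e e0; have [y' Ay' yy'] := cy e e0.
exists (a *: x' + (1 - a) *: y'); first exact: cA.
rewrite opprD addrACA -!scalerBr (le_lt_trans (ler_normD _ _))//.
rewrite !normrZ !ger0_norm ?subr_ge0//.
have lt_max : Num.max `|x - x'| `|y - y'| < e by rewrite gt_max xx' yy'.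
rewrite (le_lt_trans _ lt_max)//; set m := Num.max _ _.
have -> : m = a * m + (1 - a) * m by ring.
by rewrite lerD// ler_wpM2l ?subr_ge0// /m le_max lexx ?orbT.
Qed.

(** Encoding each ball by its centre and radius makes a finite union of balls a
    finite set of points of the vector space [X * R], where convex combinations
    of balls make sense. *)
Lemma finite_closed_balls (R : realType) (X : normedModType R) (U : set X) :
  finite_ball_unions U -> exists2 s : seq (X * R^o),
    (forall p, p \in s -> 0 < p.2) &
    U = [set y | exists2 p, p \in s & closed_ball p.1 p.2 y].
Proof.
move=> [F [/finite_seqP[t ->{F}] tB] ->].
have /choice[c cP] : forall B : set X, exists p : X * R^o,
    B \in t -> 0 < p.2 /\ B = closed_ball p.1 p.2.
  move=> B; have [/tB[z [r zr]]|_] := boolP (B \in t); last by exists 0.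
  by exists (z, r).
exists (map c t); first by move=> _ /mapP[B /cP[? _] ->].
rewrite eqEsubset; split=> [y [B /= Bt By]|y [_ /mapP[B Bt ->] By]].
  by exists (c B); [exact: map_f|rewrite -(cP B Bt).2].
by exists B => //; rewrite (cP B Bt).2.
Qed.

(** * Convex hulls of finitely many points *)

(** The convex hull of [p] and [K] when [K] is convex and nonempty: the step
    by which the hull of a finite set is built one point at a time. *)
Definition segments_from (R : realType) (V : normedModType R)
    (p : V) (K : set V) :=
  [set tk.1 *: p + (1 - tk.1) *: tk.2 | tk in `[0, 1]%classic `*` K].

Lemma segments_from_compact (R : realType) (V : normedModType R)
    (p : V) (K : set V) :
  compact K -> compact (@segments_from R V p K).
Proof.
move=> cK; apply: (@continuous_compact (R * V)%type).
  apply: continuous_subspaceT => -[t k]; apply: cvgD.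
    by apply: cvgZr_tmp; exact: cvg_fst.
  apply: cvgZ; last exact: cvg_snd.
  by apply: cvgB; [exact: cvg_cst|exact: cvg_fst].
by apply: compact_setX => //; exact: segment_compact.
Qed.

(** A combination of two points of the segments from [p] has a total weight [v]
    on points of [K]; dividing by [v] gathers these into one point of [K], unless
    [v = 0], when the combination is [p] itself. *)
Lemma segments_from_convex (R : realType) (V : normedModType R)
    (p : V) (K : set V) :
  convex_set K -> convex_set (@segments_from R V p K).
Proof.
move=> /convexP cK; apply/convexP.
move=> _ _ a [[t k] /= [+ Kk] <-] [[s l] /= [+ Kl] <-] a0 a1.
rewrite /= !in_itv /= => /andP[t0 t1] /andP[s0 s1].
pose v := a * (1 - t) + (1 - a) * (1 - s).
have v0 : 0 <= v by rewrite addr_ge0// mulr_ge0// subr_ge0.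
have [v0'|vN0] := eqVneq v 0.
  (* [k] gets weight 0 here: any point of [K] would do *)
  exists (1 - v, k) => /=.
    by rewrite v0' subr0; split=> //; rewrite /= in_itv /= ler01 lexx.
  have /eqP := v0'; rewrite paddr_eq0 ?mulr_ge0 ?subr_ge0//.
  move=> /andP[/eqP e1 /eqP e2].
  rewrite !scalerDr !scalerA e1 e2 !scale0r !addr0 -scalerDl.
  rewrite v0' subr0 subrr scale0r addr0; congr (_ *: _).
  by move: e1 e2; lra.
have v_gt0 : 0 < v by rewrite lt0r vN0.
exists (1 - v, (a * (1 - t) / v) *: k + (1 - a * (1 - t) / v) *: l) => /=.
  split=> /=; first by rewrite in_itv /= /v; apply/andP; split; nra.
  apply: cK => //; first by rewrite divr_ge0// mulr_ge0// subr_ge0.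
  by rewrite ler_pdivrMr// mul1r lerDl mulr_ge0// subr_ge0.
rewrite subKr !scalerDr !scalerA [RHS]addrACA -scalerDl.
congr (_ *: _ + (_ *: _ + _ *: _)).
- by rewrite /v; ring.
- by field.
- by rewrite mulrBr mulr1 [v * _]mulrC divfK// /v addrAC subrr add0r.
Qed.

(** The last clause says that [K] is the convex hull of [s]; it is used to prove
    properties of the points of [K] that are stable under convex combinations. *)
Lemma compact_hull (R : realType) (V : normedModType R) (s : seq V) :
  exists K : set V, [/\ compact K, convex_set K, [set` s] `<=` K &
    forall H, convex_set H -> [set` s] `<=` H -> K `<=` H].
Proof.
case: s => [|p s].
  exists set0; split; [exact: compact0| |by []|].
    by move=> x y l; rewrite in_set0.
  by move=> H _ _ x [].
elim: s p => [|q s IH] p.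
  exists [set p]; split; first exact: compact_set1.
  - apply/(@convexP R V) => _ _ a -> -> _ _ /=.
    by rewrite -scalerDl addrCA subrr addr0 scale1r.
  - by move=> x /=; rewrite mem_seq1 => /eqP.
  - by move=> H _ pH _ ->; apply: pH; rewrite /= mem_head.
have [K [kK cK sK KH]] := IH q.
exists (segments_from p K); split.
- exact: segments_from_compact.
- exact: segments_from_convex.
- move=> x /=; rewrite in_cons => /orP[/eqP->|/sK Kx].
    exists (1, q) => /=; last by rewrite scale1r subrr scale0r addr0.
    by split; rewrite /= ?in_itv /= ?ler01 ?lexx//; apply: sK; rewrite /= mem_head.
  exists (0, x) => /=; last by rewrite scale0r add0r subr0 scale1r.
  by split; rewrite //= in_itv /= ler01 lexx.
- move=> H cH psH _ [[t k] /= [+ Kk] <-]; rewrite /= in_itv /= => /andP[t0 t1].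
  move/convexP : (cH); apply=> //; first by apply: psH; rewrite /= mem_head.
  by apply: KH => // y sy; apply: psH; rewrite /= in_cons sy orbT.
Qed.

Lemma compact_finite_net (R : realType) (V : normedModType R) (K : set V) e :
  compact K -> 0 < e -> exists2 N : seq V, [set` N] `<=` K &
    forall x, K x -> exists2 y, y \in N & `|x - y| < e.
Proof.
rewrite compact_cover => cK e0.
have [|x Kx|N NK KN] := cK _ K (fun y => ball y e).
- by move=> y _; exact: ball_open.
- by exists x => //; exact: ballxx.
exists (finmap.enum_fset N); first by move=> y /NK /set_mem.
by move=> x /KN[y /= yN]; rewrite -ball_normE /= distrC; exists y.
Qed.

(** * Property (II) implies the ball generated property *)

Lemma closed_convex_hull_closed_convex (R : realType)
    (X : normedModType R) (U : set X) :
  closed (closed_convex_hull U) /\ convex_set (closed_convex_hull U).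
Proof.
split.
  by apply: (@closed_bigI _ _ _ id) => C [[cC _] _].
apply/convexP => x y a xU yU a0 a1 C CU.
have [[_ /convexP C_convex] _] := CU.
by apply: C_convex => //; [exact: xU|exact: yU].
Qed.

(** A point [z + r b], with [|b| <= 1], of the combined ball is the same
    combination of the points [z1 + r1 b] and [z2 + r2 b] of the given balls. *)
Lemma convex_closed_ball (R : realType) (X : normedModType R) (C : set X)
    (z1 z2 : X) (r1 r2 a : R) :
  convex_set C -> 0 <= a -> a <= 1 -> 0 < r1 -> 0 < r2 ->
  closed_ball z1 r1 `<=` C -> closed_ball z2 r2 `<=` C ->
  closed_ball (a *: z1 + (1 - a) *: z2) (a * r1 + (1 - a) * r2) `<=` C.
Proof.
move=> /convexP C_convex a0 a1 r1_gt0 r2_gt0 B1 B2 y.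
set z := _ + _ *: z2; set r := _ + _ * r2.
have r_gt0 : 0 < r by rewrite /r; nra.
move=> /(closed_ballP _ _ r_gt0) zy.
have [b yE br] : exists2 b, y = z + r *: b & `|b| <= 1.
  exists (r^-1 *: (y - z)).
    by rewrite scalerA divff ?gt_eqF// scale1r addrC subrK.
  by rewrite normrZ gtr0_norm ?invr_gt0// distrC ler_pdivrMl// mulr1.
have ball_point (w : X) t : 0 < t -> closed_ball w t `<=` C -> C (w + t *: b).
  move=> t0; apply; apply/closed_ballP => //.
  by rewrite opprD addNKr normrN normrZ gtr0_norm// ler_piMr// ltW.
have -> : y = a *: (z1 + r1 *: b) + (1 - a) *: (z2 + r2 *: b).
  by rewrite yE /r scalerDl -!scalerA !scalerDr addrACA.
by apply: C_convex => //; exact: ball_point.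
Qed.

(** Let [K] be the convex hull in [X * R] of the balls that make up [U]. The union
    [S] of the balls in [K] is convex, and its closure is the closed convex hull
    [C] of [U]. If [x] is at distance [d] from [C], every ball of [K] keeps its
    distance [d] from [x], and since [K] is compact, finitely many of its balls,
    enlarged by [d / 2], cover [S] and still miss [x]. *)
Lemma hull_finite_ball_union_sep (R : realType) (X : normedModType R)
    (U : set X) x :
  finite_ball_unions U -> ~ closed_convex_hull U x ->
  exists2 W, finite_ball_unions W & closed_convex_hull U `<=` W /\ ~ W x.
Proof.
move=> /finite_closed_balls[s s0 UE].
have [C_closed C_convex] := closed_convex_hull_closed_convex U.
have UC : U `<=` closed_convex_hull U by apply: sub_smallest.
set C := closed_convex_hull U in C_closed C_convex UC *.
move=> Cx.
have [d d0 dC] := closed_dist_gt0 C_closed Cx.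
have [K [K_compact K_convex sK KH]] := compact_hull s.
(* Balls contained in [C] form a convex set of pairs, so it is enough to look
   at the balls of [U]. *)
have KC p : K p -> 0 < p.2 :> R /\ closed_ball p.1 p.2 `<=` C.
  move: p; apply: KH; last first.
    move=> p ps; split; first exact: s0.
    by move=> y py; apply: UC; rewrite UE; exists p.
  apply/convexP => -[z1 r1] [z2 r2] a [/= r1_gt0 B1] [/= r2_gt0 B2] a0 a1.
  have r_gt0 : 0 < a * (r1 : R) + (1 - a) * (r2 : R).
    by move: r1_gt0 r2_gt0; nra.
  by split; [exact: r_gt0|exact: convex_closed_ball].
have KS p : K p -> (p.2 : R) + d <= `|x - p.1|.
  move=> /KC[r_gt0 pC]; have [xp|xp] := leP `|x - p.1| p.2.
    by exfalso; apply: Cx; apply: pC; apply/closed_ballP; rewrite // distrC.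
  (* the point of the ball nearest to [x] lies in [C] *)
  set n := `|x - p.1| in xp *; have n_gt0 : 0 < n by exact: lt_trans xp.
  have : C (p.1 + (p.2 / n) *: (x - p.1)).
    apply: pC; apply/closed_ballP => //.
    rewrite opprD addNKr normrN normrZ gtr0_norm ?divr_gt0//.
    by rewrite -/n divfK ?gt_eqF.
  move=> /dC; rewrite opprD addrA -[X in X - _]scale1r -scalerBl normrZ ger0_norm.
    by rewrite -/n mulrBl mul1r divfK ?gt_eqF//; lra.
  by rewrite subr_ge0 ler_pdivrMr// mul1r ltW.
pose S := [set y | exists2 p, K p & `|p.1 - y| <= p.2].
have S_convex : convex_set S.
  apply/convexP => y1 y2 a [p1 Kp1 y1p] [p2 Kp2 y2p] a0 a1.
  exists (a *: p1 + (1 - a) *: p2); first by move/convexP : K_convex; apply.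
  rewrite /= opprD addrACA -!scalerBr (le_trans (ler_normD _ _))//.
  by rewrite !normrZ !ger0_norm ?subr_ge0// lerD// ler_wpM2l// subr_ge0.
(* an error [d / 4] on the centre and one on the radius add up to [d / 2] *)
have d4_gt0 : 0 < d / 4 by rewrite divr_gt0.
have [N NK KN] := compact_finite_net K_compact d4_gt0.
pose W := \bigcup_(p in [set` N]) closed_ball p.1 (p.2 + d / 2).
have W_closed : closed W.
  apply: closed_bigcup => [|p _]; first exact: finite_seq.
  exact: closed_ball_closed.
have SW : S `<=` W.
  move=> y [p Kp yp]; have [q qN pq] := KN p Kp.
  have [q0 _] := KC q (NK q qN).
  exists q => //; apply/closed_ballP; first by lra.
  have [pq1 pq2] : `|p.1 - q.1| < d / 4 /\ `|(p.2 : R) - q.2| < d / 4.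
    by move: pq; rewrite ProdNormedZmodule.prod_normE /= gt_max => /andP[].
  have := ler_norm ((p.2 : R) - q.2); have := ler_distD p.1 q.1 y.
  by rewrite (distrC q.1 p.1); lra.
exists W.
  exists ((fun p => closed_ball p.1 (p.2 + d / 2)) @` [set` N]).
    split; first by apply: finite_image; exact: finite_seq.
    move=> _ [q /NK/KC[q0 _] <-].
    by exists q.1, (q.2 + d / 2); split=> //; lra.
  by rewrite bigcup_image.
split.
  have : closure S `<=` W by rewrite (closure_id W).1//; exact: closureS.
  move=> clSW y Cy; apply: clSW; apply: Cy; split.
    by split; [exact: closed_closure|exact: closure_convex].
  rewrite UE => z [p ps /closed_ballP zp]; apply: subset_closure.
  by exists p; [exact: sK|apply: zp; exact: s0].
move=> [q /NK Kq /closed_ballP]; have [q0 _] := KC q Kq; have qx := KS q Kq.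
have r_gt0 : 0 < q.2 + d / 2 by lra.
by move=> /(_ r_gt0); rewrite distrC; lra.
Qed.

Lemma property_II_BGP (R : realType) (X : normedModType R) :
  property_II X -> BGP X.
Proof.
move=> II A cA bA vA; apply/intersection_ofP => x Ax.
have /intersection_ofP/(_ x Ax)[_ [U UF <-] [AU Ux]] := II A cA bA vA.
have [W WF [UW Wx]] := hull_finite_ball_union_sep UF Ux.
by exists W => //; split=> // y /AU/UW.
Qed.

(** * Functionals dominated on a subspace of finite codimension *)

Section DualFunctional.
Variables (R : realType) (X : normedModType R).
Implicit Types (f g : dual X) (x y : X).

Lemma dual_fun0 f : f 0 = 0.
Proof. by have := dual_linear f (-1) 0 0; rewrite scaler0 addr0 scaleN1r addNr. Qed.

Lemma dual_funD f x y : f (x + y) = f x + f y.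
Proof. by have := dual_linear f 1 x y; rewrite !scale1r. Qed.

Lemma dual_funZ f a x : f (a *: x) = a * f x.
Proof. by have := dual_linear f a x 0; rewrite dual_fun0 !addr0. Qed.

Lemma dual_funN f x : f (- x) = - f x.
Proof. by rewrite -scaleN1r dual_funZ mulN1r. Qed.

Lemma dual_funB f x y : f (x - y) = f x - f y.
Proof. by rewrite dual_funD dual_funN. Qed.

Lemma dual_fun_le_norm f x : `|f| <= 1 -> f x <= `|x|.
Proof.
move=> f1; have [->|x0] := eqVneq x 0; first by rewrite dual_fun0 normr0.
have x_gt0 : 0 < `|x| by rewrite normr_gt0.
have : `|f (`|x|^-1 *: x)| <= 1.
  apply: le_trans f1; apply: dual_norm_ub.
  by rewrite normrZ normfV normr_id mulVf ?gt_eqF.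
rewrite dual_funZ => /(le_trans (ler_norm _)).
by rewrite ler_pdivrMl// mulr1.
Qed.

Lemma dual_norm_le_bound f c : 0 <= c -> (forall x, f x <= c * `|x|) -> `|f| <= c.
Proof.
move=> c0 fc; apply: dual_norm_le => x x1.
have cx : c * `|x| <= c by rewrite ler_piMr.
rewrite ler_norml; apply/andP; split; last exact: le_trans (fc x) cx.
have := fc (- x); rewrite dual_funN normrN; lra.
Qed.

(** The one-dimensional step of the Hahn-Banach theorem. By homogeneity, outside
    the kernel of [g] only the points [y] of [Y] with [g y = 1] or [g (- y) = 1]
    matter, so [t] must satisfy [f y - c |y| <= t <= f z + c |z|] whenever
    [g y = g z = 1]. The hypothesis applied to [y - z] shows that each lower
    bound is at most each upper one, so the supremum of the lower bounds will
    do. *)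
Lemma dominated_kernel_extension (Y : set X) f g c :
  submod_closed (mem Y) -> 0 <= c ->
  (forall y, Y y -> g y = 0 -> f y <= c * `|y|) ->
  exists t : R, forall y, Y y -> (f - t *: g) y <= c * `|y|.
Proof.
move=> [Y0 Ysub] c0 fc.
have YB a x y : Y x -> Y y -> Y (a *: x + y).
  by move=> Yx Yy; have := Ysub a x y; rewrite !inE; exact.
move/set_mem in Y0.
have [g0|] := pselect (forall y, Y y -> g y = 0).
  exists 0 => y Yy; rewrite scale0r subr0; apply: fc => //; exact: g0.
move=> /existsNP[y0 /not_implyP[Yy0 /eqP gy0]].
pose E := [set f y - c * `|y| | y in [set y | Y y /\ g y = 1]].
have E0 : E !=set0.
  exists (f ((g y0)^-1 *: y0) - c * `|(g y0)^-1 *: y0|), ((g y0)^-1 *: y0) => //.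
  by split; [rewrite -[_ *: _]addr0; exact: YB|rewrite dual_funZ mulVf].
have Eub z : Y z -> g z = 1 -> ubound E (f z + c * `|z|).
  move=> Yz gz _ [y [Yy gy] <-].
  have : f (y - z) <= c * `|y - z|.
    apply: fc; last by rewrite dual_funB gy gz subrr.
    by rewrite addrC -scaleN1r; exact: YB.
  have := ler_wpM2l c0 (ler_normB y z); rewrite dual_funB; lra.
have [z [Yz gz]] : exists z, Y z /\ g z = 1.
  by case: E0 => _ [z Yz _]; exists z.
have E_has_ub : has_ubound E by exists (f z + c * `|z|); exact: Eub.
exists (sup E) => y Yy.
have fgE : (f - sup E *: g) y = f y - sup E * g y by [].
rewrite fgE.
have YZ a : Y (a *: y) by rewrite -[_ *: _]addr0; exact: YB.
have [gy|gy|gy] := ltgtP (g y) 0; last by rewrite gy mulr0 subr0 fc.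
- have : sup E <= f ((g y)^-1 *: y) + c * `|(g y)^-1 *: y|.
    apply: ge_sup E0 _; apply: Eub => //.
    by rewrite dual_funZ mulVf ?lt_eqF.
  rewrite dual_funZ normrZ normfV ltr0_norm// invrN => H.
  have := ler_wpM2r (ltW (_ : 0 < - g y)) H; rewrite oppr_gt0 => /(_ gy).
  have -> : ((g y)^-1 * f y + c * (- (g y)^-1 * `|y|)) * - g y = - f y + c * `|y|.
    by field; rewrite lt_eqF.
  lra.
- have : f ((g y)^-1 *: y) - c * `|(g y)^-1 *: y| <= sup E.
    apply: ub_le_sup => //; exists ((g y)^-1 *: y) => //; split=> //.
    by rewrite dual_funZ mulVf ?gt_eqF.
  rewrite dual_funZ normrZ normfV gtr0_norm// => H.
  have := ler_wpM2r (ltW gy) H.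
  have -> : ((g y)^-1 * f y - c * ((g y)^-1 * `|y|)) * g y = f y - c * `|y|.
    by field; rewrite gt_eqF.
  lra.
Qed.

(** The distance from [f] to the span of [gs] is at most the norm of [f] on the
    common kernel of [gs]: remove the functionals one at a time, taking the
    common kernel of the others as the subspace [Y] of the one-step extension. *)
Lemma dominated_modulo_span (F : set (dual X)) (gs : seq (dual X)) f c :
  submod_closed (mem F) -> 0 <= c -> [set` gs] `<=` F ->
  (forall y, (forall g, g \in gs -> g y = 0) -> f y <= c * `|y|) ->
  exists2 g, F g & forall x, (f - g) x <= c * `|x|.
Proof.
move=> [/set_mem F0 Fsub] c0; elim: gs f => [|g gs IH] f gsF fc.
  by exists 0 => // x; rewrite subr0; apply: fc.
pose Y := [set y | forall h, h \in gs -> h y = 0].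
have Y_sub : submod_closed (mem Y).
  split=> [|a x y /set_mem Yx /set_mem Yy].
    by apply/mem_set => h _; exact: dual_fun0.
  apply/mem_set => h hgs.
  by rewrite dual_funD dual_funZ (Yx h)// (Yy h)// mulr0 addr0.
have [|t ft] := @dominated_kernel_extension Y f g c Y_sub c0.
  move=> y Yy gy; apply: fc => h; rewrite in_cons => /orP[/eqP->//|]; exact: Yy.
have [h hgs|y|h Fh fh] := IH (f - t *: g).
- by apply: gsF; rewrite /= in_cons hgs orbT.
- exact: ft.
exists (t *: g + h); last by move=> x; rewrite opprD addrA.
by apply/set_mem/Fsub; apply/mem_set => //; apply: gsF; rewrite /= mem_head.
Qed.

(** * The ball generated property implies nice smoothness *)

(** Suppose that [f] lies at distance [e > 0] from a norming subspace [F], and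
    let [0 < c < e]. The part of the unit ball where [c <= f] does not contain 0,
    so it is covered by finitely many balls missing 0. As [F] is norming, each of
    these balls lies in a half-space [0 < g] with [g] in [F]. Hence [f <= c |y|]
    where all these [g] vanish, so [f] is within [c] of [F]: a contradiction. *)
Lemma BGP_nicely_smooth : BGP X -> nicely_smooth X.
Proof.
move=> bgp [F [[F_closed F_sub] [_ F_norming]] [_ /existsNP[f /not_implyP[_ Ff]]]].
have [e e0 eF] := closed_dist_gt0 F_closed Ff.
pose c := e / 2; have c0 : 0 < c by rewrite divr_gt0.
pose A := [set x : X | `|x| <= 1 /\ c <= f x].
have A_closed : closed A.
  apply: closedI.
    apply: (@closed_comp _ _ (fun x : X => `|x|) [set r | r <= 1]).
      by move=> x _; exact: norm_continuous.
    exact: closed_le.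
  apply: (@closed_comp _ _ f [set r | c <= r]); last exact: closed_ge.
  by move=> x _; exact: dual_continuous.
have A_bounded : bounded_set A.
  exists 1; split=> // M M1 x [x1 _]; exact: le_trans x1 (ltW M1).
have A_convex : convex_set A.
  apply/convexP => x y a [x1 fx] [y1 fy] a0 a1; split.
    rewrite (le_trans (ler_normD _ _))// !normrZ !ger0_norm ?subr_ge0//.
    by nra.
  by rewrite dual_funD !dual_funZ; nra.
have A0 : ~ A 0 by rewrite /A /= dual_fun0 => -[_]; rewrite leNgt c0.
have /intersection_ofP/(_ 0 A0)[U /finite_closed_balls[s s0 ->] [AU U0]] :=
  bgp A A_closed A_bounded A_convex.
(* The ball misses 0, so its radius is less than the norm of its centre, which
   some [g] of norm at most 1 in [F] almost attains. *)
have /choice[G GP] : forall p : X * R^o, exists g : dual X, p \in s ->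
    F g /\ forall x, closed_ball p.1 p.2 x -> 0 < g x.
  move=> p; have [ps|_] := boolP (p \in s); last by exists 0.
  have r_gt0 := s0 p ps.
  have : (p.2%:E < `|p.1|%:E)%E.
    rewrite lte_fin ltNge; apply/negP => zr; apply: U0; exists p => //.
    by apply/closed_ballP; rewrite // subr0.
  rewrite F_norming => /ereal_sup_gt[_ [g [Fg g1] <-]]; rewrite lte_fin => rg.
  exists g => _; split=> // x /(closed_ballP _ _ r_gt0) zx.
  have := dual_fun_le_norm (p.1 - x) g1; rewrite dual_funB; lra.
have [|y yG|g Fg fg] := @dominated_modulo_span F (map G s) f c F_sub (ltW c0).
- by move=> _ /= /mapP[p ps ->]; exact: (GP p ps).1.
- rewrite leNgt; apply/negP => fy.
  have y_gt0 : 0 < `|y|.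
    rewrite normr_gt0; apply: contraTneq fy => ->.
    by rewrite dual_fun0 normr0 mulr0 ltxx.
  have /AU[p ps /(GP p ps).2] : A (`|y|^-1 *: y).
    split; first by rewrite normrZ normfV normr_id mulVf ?gt_eqF.
    by rewrite dual_funZ ler_pdivlMl// mulrC ltW.
  by rewrite dual_funZ yG ?mulr0 ?ltxx//; exact: map_f.
- have := eF g Fg; have := dual_norm_le_bound (ltW c0) fg; rewrite /c; lra.
Qed.

End DualFunctional.

Theorem corollary5 (R : realType) (X : completeNormedModType R) :
  (property_II X -> BGP X) /\ (BGP X -> nicely_smooth X).
Proof. by split; [exact: property_II_BGP|exact: BGP_nicely_smooth]. Qed.
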